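(* For $n \ge 3$ let $Pi_n$ be the graph with vertex set $\{1,\dots,n\}$ in which distinct $i,j$ are adjacent if and only if $(i-j) \bmod n \in \{0,1,\dots,\lfloor n/4\rfloor\}$ or $(j-i) \bmod n \in \{0,1,\dots,\lfloor n/4\rfloor\}$. Then \[ \lim_{n\to\infty}\frac{\lambda_3(Pi_n)}{n} = \frac{1}{\pi}. \]
   Context: $\lambda_3$ denotes the third largest eigenvalue (with multiplicity) of the adjacency matrix. *)

(* Defs.v *)
From HB Require Import structures.
From mathcomp Require Import all_boot all_order all_algebra.
From mathcomp Require Import all_classical all_reals all_analysis.
Set Implicit Arguments. Unset Strict Implicit. Unset Printing Implicit Defensive.
Import Order.TTheory GRing.Theory Num.Theory.
Local Open Scope ring_scope.

(* Vertices of Pi_n are 'I_n = {0,...,n-1} (a shift of {1,...,n});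
   adjacency depends only on differences mod n. *)
Definition Pi_adj (n : nat) (i j : 'I_n) : bool :=
  (i != j) &&
  ((((i + n - j) %% n) <= n %/ 4)%N || (((j + n - i) %% n) <= n %/ 4)%N).

Definition Pi_mx (R : realType) (n : nat) : 'M[R]_n :=
  \matrix_(i, j) (Pi_adj i j)%:R.

Definition eigen_seq (R : realType) (n : nat) (A : 'M[R]_n) (s : seq R) : Prop :=
  sorted (fun x y : R => y <= x) s /\ char_poly A = \prod_(x <- s) ('X - x%:P).

(* k-th largest eigenvalue (1-based: eig_k 1 is the largest), with multiplicity. *)
Definition eig_k (R : realType) (n : nat) (A : 'M[R]_n) (k : nat) : R :=
  xget 0 [set x | exists s, eigen_seq A s /\ nth 0 s k.-1 = x].

(* Main.v *)
(** The Hartley matrix with entries cas(2 pi j k / n), where cas = cos + sin,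
    squares to n times the identity, and the identity
    cas (x + y) + cas (x - y) = 2 cos y * cas x makes its columns eigenvectors
    of every symmetric circulant matrix.  With m = floor(n/4), the eigenvalues
    of Pi_n are therefore P_k = 2 \sum_(1 <= d <= m) cos(2 pi k d / n), and the
    Dirichlet kernel gives sin(pi k / n) (P_k + 1) = sin((2m+1) pi k / n).
    Since (2m+1) pi / n is within pi / n of pi / 2, the right-hand side for
    k = 1 lies between cos(pi / n) and 1.  For 2 <= k <= n - 2 one has
    sin(pi k / n) >= sin(2 pi / n), so P_k <= P_1 = P_(n-1) <= P_0 once n >= 4,
    and the bounds on P_1 squeeze P_1 / n towards 1 / pi. *)
Require Import Defs.
From HB Require Import structures.
From mathcomp Require Import all_boot all_order all_algebra.
From mathcomp Require Import all_classical all_reals all_analysis.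
From mathcomp Require Import ring lra zify.
Import Order.TTheory GRing.Theory Num.Theory numFieldNormedType.Exports.
Local Open Scope classical_set_scope.
Local Open Scope ring_scope.


(** * Characteristic polynomials and sorted spectra *)

(** Over polynomials the relation becomes [(X - A) H = H (X - D)]; taking determinants and
    cancelling the nonzero constant [\det H] avoids inverting [H]. *)
Lemma char_poly_eigenbasis (F : fieldType) (n : nat) (A H : 'M[F]_n)
    (d : 'I_n -> F) :
  \det H != 0 -> A *m H = H *m diag_mx (\row_k d k) ->
  char_poly A = \prod_k ('X - (d k)%:P).
Proof.
move=> detH AH.
have DE : char_poly (diag_mx (\row_k d k)) = \prod_k ('X - (d k)%:P).
  rewrite char_poly_trig ?diag_mx_is_trig//.
  by apply: eq_bigr => k _; rewrite !mxE eqxx mulr1n.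
rewrite -DE /char_poly; set D := diag_mx _.
have E : char_poly_mx A *m map_mx polyC H = map_mx polyC H *m char_poly_mx D.
  rewrite /char_poly_mx mulmxBl mulmxBr -!map_mxM AH.
  by rewrite scalar_mxC.
move/(congr1 determinant): E; rewrite !det_mulmx mulrC.
by move/mulfI; apply; rewrite det_map_mx polyC_eq0.
Qed.

(** Unique factorization fixes the roots up to permutation and sorting fixes their order, so the
    choice made by [xget] is immaterial. *)
Lemma eig_kE (R : realType) (n : nat) (A : 'M[R]_n) (s : seq R) (k : nat) :
  eigen_seq A s -> eig_k A k = nth 0 s k.-1.
Proof.
move=> As; rewrite /eig_k.
have sE : [set x | exists s, eigen_seq A s /\ nth 0 s k.-1 = x] (nth 0 s k.-1).
  by exists s.
have [t [[t_sorted At] <-]] := xgetPex 0 (ex_intro _ _ sE).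
congr nth; case: As => s_sorted As.
apply: (sorted_eq _ _ t_sorted s_sorted).
- by move=> x y z; apply: ge_trans.
- by move=> x y; rewrite andbC; apply: le_anti.
- by apply: prod_XsubC_eq; rewrite -At As.
Qed.

(** * Half angles and trigonometric sums over arithmetic progressions *)

Section Angles.
Variable R : realType.

(* Half angles: the circulant angle 2 pi k / n is [ang n k *+ 2]. *)
Definition ang (n k : nat) : R := pi * k%:R / n%:R.

Lemma angD n a b : ang n (a + b) = ang n a + ang n b.
Proof. by rewrite /ang natrD mulrDr mulrDl. Qed.

Lemma angB n a b : (b <= a)%N -> ang n (a - b) = ang n a - ang n b.
Proof. by move=> ba; rewrite -{2}(subnK ba) angD addrK. Qed.

Lemma angM n a b : ang n (a * b) = ang n a *+ b.
Proof. by rewrite /ang natrM -[in RHS]mulr_natr; ring. Qed.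

Lemma ang_self n : (0 < n)%N -> ang n n = pi.
Proof. by move=> n0; rewrite /ang mulfK// pnatr_eq0 -lt0n. Qed.

Lemma ang0 n : ang n 0 = 0.
Proof. by rewrite /ang mulr0 mul0r. Qed.

Lemma ang_gt0 n k : (0 < n)%N -> (0 < k)%N -> 0 < ang n k.
Proof. by move=> n0 k0; rewrite /ang divr_gt0 ?ltr0n// mulr_gt0 ?pi_gt0 ?ltr0n. Qed.

Lemma ler_ang n k l : (k <= l)%N -> ang n k <= ang n l.
Proof.
by move=> kl; rewrite /ang ler_wpM2r ?invr_ge0 ?ler0n// ler_wpM2l ?pi_ge0 ?ler_nat.
Qed.

Lemma ltr_ang n k l : (0 < n)%N -> (k < l)%N -> ang n k < ang n l.
Proof.
by move=> n0 kl; rewrite /ang ltr_pM2r ?invr_gt0 ?ltr0n// ltr_pM2l ?pi_gt0 ?ltr_nat.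
Qed.

Lemma sin_ang_gt0 n k : (0 < k < n)%N -> 0 < sin (ang n k).
Proof.
move=> /andP[k0 kn]; have n0 : (0 < n)%N by apply: leq_ltn_trans kn.
by rewrite sin_gt0_pi// ang_gt0//= -[ltRHS](ang_self n)// ltr_ang.
Qed.

Lemma sin_ang_sub_neq0 n (i k : 'I_n) : i != k -> sin (ang n i - ang n k) != 0.
Proof.
have aux (a b : 'I_n) : (a < b)%N -> sin (ang n b - ang n a) != 0.
  move=> ab; rewrite -(subnKC (ltnW ab)) angD addrC addKr gt_eqF//.
  by apply: sin_ang_gt0; have := ltn_ord b; lia.
rewrite neq_ltn => /orP[|/aux//].
by move=> /aux; rewrite -opprB sinN oppr_eq0.
Qed.

Lemma sin_ang2_mod n a : (0 < n)%N -> sin (ang n (a %% n) *+ 2) = sin (ang n a *+ 2).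
Proof.
move=> n0; rewrite {2}(divn_eq a n) addnC angD mulnC angM ang_self// mulrnDl.
by rewrite mulrnAC (periodicn (@sinD2pi R)).
Qed.

Lemma cos_ang2_mod n a : (0 < n)%N -> cos (ang n (a %% n) *+ 2) = cos (ang n a *+ 2).
Proof.
move=> n0; rewrite {2}(divn_eq a n) addnC angD mulnC angM ang_self// mulrnDl.
by rewrite mulrnAC (periodicn (@cosD2pi R)).
Qed.

(** Telescoping of [2 sin y cos(2jy) = sin((2j+1)y) - sin((2j-1)y)]; keeping [sin y] as a factor
    avoids dividing by zero. *)
Lemma sum_cos_multiples (y : R) n :
  sin y * (\sum_(0 <= j < n) cos (y *+ 2 *+ j) *+ 2) = sin (y *+ 2 *+ n - y) + sin y.
Proof.
elim: n => [|n IH].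
  by rewrite big_geq// mulr0 mulr0n sub0r sinN addNr.
rewrite big_nat_recr//= mulrDr IH (mulrSr (y *+ 2)) sinB.
rewrite (_ : _ + y *+ 2 - y = y *+ 2 *+ n + y); last ring.
by rewrite sinD; ring.
Qed.

Lemma sum_sin_multiples (y : R) n :
  sin y * (\sum_(0 <= j < n) sin (y *+ 2 *+ j) *+ 2) = cos y - cos (y *+ 2 *+ n - y).
Proof.
elim: n => [|n IH].
  by rewrite big_geq// mulr0 mulr0n sub0r cosN subrr.
rewrite big_nat_recr//= mulrDr IH (mulrSr (y *+ 2)) cosB.
rewrite (_ : _ + y *+ 2 - y = y *+ 2 *+ n + y); last ring.
by rewrite cosD; ring.
Qed.

Lemma sin_mulrn_eq0 (y : R) n : sin y = 0 -> sin (y *+ n) = 0.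
Proof.
move=> y0; elim: n => [|n IH]; first by rewrite mulr0n sin0.
by rewrite mulrSr sinD IH y0 mul0r mulr0 addr0.
Qed.

Lemma mulr2n_eq0 (x : R) : x *+ 2 = 0 -> x = 0.
Proof. by move=> x0; lra. Qed.

Lemma sum_cos_period (y : R) n : sin y != 0 -> sin (y *+ 2 *+ n - y) = - sin y ->
  \sum_(j < n) cos (y *+ 2 *+ j) = 0.
Proof.
move=> y0 yn; apply: mulr2n_eq0; rewrite -sumrMnl.
apply: (mulfI y0); rewrite mulr0 -(big_mkord xpredT (fun j => cos (y *+ 2 *+ j) *+ 2)).
by rewrite sum_cos_multiples yn addNr.
Qed.

Lemma sum_sin_period (y : R) n : cos (y *+ 2 *+ n - y) = cos y ->
  \sum_(j < n) sin (y *+ 2 *+ j) = 0.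
Proof.
(* If [sin y = 0] the factor cannot be cancelled, but then every summand is already zero. *)
move=> yn; have [y0|y0] := eqVneq (sin y) 0.
  by apply: big1 => j _; rewrite -mulrnA sin_mulrn_eq0.
apply: mulr2n_eq0; rewrite -sumrMnl.
apply: (mulfI y0); rewrite mulr0 -(big_mkord xpredT (fun j => sin (y *+ 2 *+ j) *+ 2)).
by rewrite sum_sin_multiples yn subrr.
Qed.

Lemma sinB2pin (x : R) m : sin (x - pi *+ 2 *+ m) = sin x.
Proof. by rewrite -[in RHS](subrK (pi *+ 2 *+ m) x) (periodicn (@sinD2pi R)). Qed.

(** * The Hartley matrix *)

Definition cas (x : R) : R := cos x + sin x.

Lemma casM (x y : R) : cas x * cas y = cos (x - y) + sin (x + y).
Proof. by rewrite /cas cosB sinD; ring. Qed.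

Lemma ler_cos : {in `[0, pi] &, {mono (@cos R) : x y /~ x <= y}}.
Proof. by apply: le_nmono_in => x y xpi ypi xy; rewrite ltr_cos. Qed.

Lemma ler_sin : {in `[- (pi / 2), pi / 2] &, {mono (@sin R) : x y / x <= y}}.
Proof. by apply: le_mono_in => x y xpi ypi xy; rewrite ltr_sin. Qed.

Lemma cas_sym (x y : R) : cas (x + y) + cas (x - y) = cos y *+ 2 * cas x.
Proof. by rewrite /cas cosB cosD sinD sinB; ring. Qed.

Definition Hartley n : 'M[R]_n := \matrix_(i, k) cas (ang n (i * k) *+ 2).

(** By [casM] each entry splits into a sine sum of step [2 ang n (i + k)], which always vanishes,
    and a cosine sum of step [2 (ang n i - ang n k)], which vanishes off the diagonal and equals [n]
    on it. *)
Lemma Hartley_sqr n : Hartley n *m Hartley n = n%:R%:M.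
Proof.
apply/matrixP => i k; rewrite !mxE.
have n0 : (0 < n)%N by case: n i k => // -[].
under eq_bigr => j _ do rewrite !mxE casM.
rewrite big_split/=.
have -> : \sum_(j < n) sin (ang n (i * j) *+ 2 + ang n (j * k) *+ 2) = 0.
  have per : cos (ang n (i + k) *+ 2 *+ n - ang n (i + k)) = cos (ang n (i + k)).
    rewrite mulrnAC -angM mulnC angM ang_self// mulrnAC addrC.
    by rewrite (periodicn (@cosD2pi R)) cosN.
  apply: etrans (sum_sin_period _ _ per); apply: eq_bigr => j _; congr sin.
  by rewrite (mulnC j) !angM angD; ring.
rewrite addr0.
have [<-|ik] := eqVneq i k.
  rewrite mulr1n (eq_bigr (fun=> 1)) ?sumr_const ?card_ord// => j _.
  by rewrite mulnC subrr cos0.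
have per : sin ((ang n i - ang n k) *+ 2 *+ n - (ang n i - ang n k)) =
    - sin (ang n i - ang n k).
  have -> : (ang n i - ang n k) *+ 2 *+ n = pi *+ 2 *+ i - pi *+ 2 *+ k.
    rewrite -mulrnA mulnC mulrnA mulrnBl -!angM ![(_ * n)%N]mulnC !angM ang_self//.
    by ring.
  by rewrite addrAC sinB2pin addrC (periodicn (@sinD2pi R)) sinN.
rewrite mulr0n; apply: etrans (sum_cos_period _ _ (sin_ang_sub_neq0 _ _ _ ik) per).
by apply: eq_bigr => j _; congr cos; rewrite (mulnC j) !angM; ring.
Qed.

Lemma det_Hartley_neq0 n : \det (Hartley n) != 0.
Proof.
case: n => [|n]; first by rewrite det_mx00 oner_neq0.
apply/eqP => H0; have /(congr1 determinant)/eqP := Hartley_sqr n.+1.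
by rewrite det_mulmx H0 mul0r det_scalar eq_sym expf_eq0/= pnatr_eq0.
Qed.

(** * Spectrum of the circulant graph *)

Definition Pi_eig n k : R := \sum_(1 <= d < (n %/ 4).+1) cos (ang n (k * d) *+ 2) *+ 2.

(** Pairs the two neighbours at circular distance [d]. The bound [m.*2 < N] keeps the two arcs
    disjoint, so the indicator of their union is a sum; the second arc is then reversed. *)
Lemma sum_circular_window (f : nat -> R) N m : (m.*2 < N)%N ->
  \sum_(0 <= d < N) ((1 <= d <= m) || (1 <= N - d <= m))%N%:R * f d =
  \sum_(1 <= d < m.+1) (f d + f (N - d)%N).
Proof.
move=> mN; have mN' : (m.+1 <= N)%N by lia.
rewrite big_ltn ?(leq_trans _ mN')//= subn0 (_ : _ && _ = false) ?mul0r ?add0r; last by lia.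
have -> : \sum_(1 <= d < N) ((1 <= d <= m) || (1 <= N - d <= m))%N%:R * f d =
  \sum_(1 <= d < N) (if (d < m.+1)%N then f d else 0) +
  \sum_(1 <= d < N) (if (N - d < m.+1)%N then f d else 0).
  rewrite -big_split/= big_nat_cond [RHS]big_nat_cond.
  apply: eq_bigr => d /andP[dN _].
  case: (ltnP d m.+1) => d1; case: (ltnP (N - d) m.+1) => d2.
  - by exfalso; lia.
  - by rewrite (_ : _ || _ = true) ?mul1r ?addr0//; lia.
  - by rewrite (_ : _ || _ = true) ?mul1r ?add0r//; lia.
  - by rewrite (_ : _ || _ = false) ?mul0r ?addr0//; lia.
rewrite [X in _ + X]big_nat_rev/= big_split/=.
congr (_ + _).
  by rewrite [RHS](big_nat_widen _ _ _ _ _ mN') [RHS]big_mkcond.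
rewrite [RHS](big_nat_widen _ _ _ _ _ mN') [RHS]big_mkcond/=.
rewrite big_nat_cond [RHS]big_nat_cond.
apply: eq_bigr => d /andP[dN _].
by rewrite add1n subSS subKn//; lia.
Qed.

Lemma Pi_adj_add n (i d : 'I_n.+1) :
  Pi_adj i (i + d) =
  (1 <= d <= n.+1 %/ 4)%N || (1 <= n.+1 - d <= n.+1 %/ 4)%N.
Proof.
have [iN dN] := (ltn_ord i, ltn_ord d).
rewrite /Pi_adj -(inj_eq val_inj)/=.
(* The sum in ['I_n.+1] is modular, so the cases are whether [i + d] wraps around. *)
have [idN|idN] := ltnP (i + d) n.+1.
  rewrite (modn_small idN) (_ : i + d + n.+1 - i = d + n.+1)%N; last lia.
  rewrite modnDr (modn_small dN) (_ : i + n.+1 - (i + d) = n.+1 - d)%N; last lia.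
  have [d0|d0] := posnP d; first by rewrite d0 subn0 modnn; lia.
  by rewrite modn_small; lia.
have E : ((i + d) %% n.+1 = i + d - n.+1)%N.
  by rewrite -[in LHS](subnK idN) modnDr modn_small; lia.
rewrite E (_ : i + d - n.+1 + n.+1 - i = d)%N ?(modn_small dN); last lia.
rewrite (_ : i + n.+1 - (i + d - n.+1) = n.+1 - d + n.+1)%N; last lia.
by rewrite modnDr modn_small; lia.
Qed.

Lemma cas_ang2_mod n a : (0 < n)%N -> cas (ang n (a %% n) *+ 2) = cas (ang n a *+ 2).
Proof. by move=> n0; rewrite /cas cos_ang2_mod ?sin_ang2_mod. Qed.

(** Rows are indexed by the offset from [i]; offsets [d] and [n - d] then combine through
    [cas_sym]. *)
Lemma Pi_mx_Hartley n :
  Pi_mx R n *m Hartley n = Hartley n *m diag_mx (\row_k Pi_eig n k).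
Proof.
case: n => [|n]; first by apply/matrixP => -[].
apply/matrixP => i k; rewrite mul_mx_diag !mxE (reindex_inj (addrI i))/=.
pose c d := cas (ang n.+1 ((i + d) * k) *+ 2).
have -> : \sum_j Pi_mx R n.+1 i (i + j) * Hartley n.+1 (i + j) k =
  \sum_(j < n.+1) ((1 <= j <= n.+1 %/ 4) || (1 <= n.+1 - j <= n.+1 %/ 4))%N%:R * c j.
  apply: eq_bigr => j _; rewrite !mxE Pi_adj_add; congr (_ * _).
  by rewrite /c -cas_ang2_mod//= modnMml cas_ang2_mod.
rewrite -(big_mkord xpredT (fun j =>
  ((1 <= j <= n.+1 %/ 4) || (1 <= n.+1 - j <= n.+1 %/ 4))%N%:R * c j)).
rewrite sum_circular_window; last by lia.
rewrite /Pi_eig big_distrr/= big_nat_cond [RHS]big_nat_cond.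
apply: eq_bigr => d /andP[dN _].
have E1 : ang n.+1 ((i + d) * k) *+ 2 = ang n.+1 (i * k) *+ 2 + ang n.+1 (k * d) *+ 2.
  by rewrite (mulnC k) mulnDl angD mulrnDl.
(* Offset [n - d] acts as [-d], up to [k] full turns. *)
have E2 : ang n.+1 ((i + (n.+1 - d)) * k) *+ 2 =
    ang n.+1 (i * k) *+ 2 - ang n.+1 (k * d) *+ 2 + pi *+ 2 *+ k.
  rewrite (mulnC k) !angM angD angB ?ang_self//; last by lia.
  by ring.
rewrite mulrC -cas_sym /c E1 E2; congr (_ + _).
by rewrite /cas (periodicn (@cosD2pi R)) (periodicn (@sinD2pi R)).
Qed.

Lemma Pi_char_poly n : char_poly (Pi_mx R n) = \prod_(k < n) ('X - (Pi_eig n k)%:P).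
Proof.
exact: char_poly_eigenbasis (det_Hartley_neq0 n) (Pi_mx_Hartley n).
Qed.

Lemma Pi_eig_rev n k : (0 < n)%N -> (k <= n)%N -> Pi_eig n (n - k) = Pi_eig n k.
Proof.
move=> n0 kn; apply: eq_bigr => d _; congr (_ *+ 2).
rewrite !angM angB// ang_self// -[RHS]cosN mulrnBl mulrnBl [pi *+ _ *+ _]mulrnAC.
by rewrite addrC (periodicn (@cosD2pi R)).
Qed.

(** * Dirichlet kernel bounds and the order of the eigenvalues *)

Definition dirichlet n k : R := sin (ang n (k * (n %/ 4).*2.+1)).

Lemma Pi_eig_dirichlet n k : sin (ang n k) * (Pi_eig n k + 1) = dirichlet n k.
Proof.
have := sum_cos_multiples (ang n k) (n %/ 4).+1.
(* The term at index 0 is 2, whereas the kernel identity has 1; the spare [sin (ang n k)] cancels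
   the one on the right of the telescoped sum. *)
rewrite big_ltn// mulr0n cos0 (_ : \sum_(_ <= _ < _) _ = Pi_eig n k).
  have -> : ang n k *+ 2 *+ (n %/ 4).+1 - ang n k = ang n (k * (n %/ 4).*2.+1).
    by rewrite angM -mulrnA mul2n doubleS mulrS addrAC subrr add0r.
  by rewrite -/(dirichlet n k) => E; lra.
by apply: eq_bigr => d _; rewrite angM mulrnAC.
Qed.

Lemma Pi_eig_le0 n k : Pi_eig n k <= Pi_eig n 0.
Proof.
apply: ler_sum => d _; rewrite mul0n ang0 mul0rn cos0 lerMn2r.
by rewrite cos_le1.
Qed.

(** With [m = n %/ 4], [4m <= n <= 4m + 4] puts [2m + 1] within 1 of [n / 2]; the sine is then the
    cosine of an angle of size at most [ang n 1]. *)
Lemma dirichlet1_ge n : (2 <= n)%N -> cos (ang n 1) <= dirichlet n 1.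
Proof.
move=> n2; rewrite /dirichlet mul1n -cosBpihalf -(cos_norm (_ - _)).
have n0 : (0 : R) < n%:R by rewrite ltr0n; lia.
have le1 : ang n 1 <= pi by rewrite -[leRHS](@ang_self n) ?ler_ang//; lia.
have D : `|ang n (n %/ 4).*2.+1 - pi / 2| <= ang n 1.
  rewrite /ang (_ : _ - _ = pi / n%:R * ((n %/ 4).*2.+1%:R - n%:R / 2)); last first.
    by field; rewrite gt_eqF.
  rewrite normrM ger0_norm ?divr_ge0 ?pi_ge0 ?ler0n// mulr1.
  rewrite ler_piMr ?divr_ge0 ?pi_ge0 ?ler0n//.
  have lb : n%:R <= (n %/ 4)%:R * 4 + 4 :> R by rewrite -natrM -natrD ler_nat; lia.
  have ub : (n %/ 4)%:R * 4 <= n%:R :> R by rewrite -natrM ler_nat; lia.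
  have -> : (n %/ 4).*2.+1%:R = (n %/ 4)%:R * 2 + 1 :> R.
    by rewrite -natr1 -muln2 natrM.
  by rewrite ler_norml; apply/andP; split; lra.
rewrite ler_cos ?in_itv/= ?normr_ge0 ?(le_trans D le1)//.
by rewrite le1 andbT ltW ?ang_gt0//; lia.
Qed.

Lemma Pi_eig1_bounds n : (2 <= n)%N ->
  cos (ang n 1) / sin (ang n 1) - 1 <= Pi_eig n 1 <= (sin (ang n 1))^-1 - 1.
Proof.
move=> n2; have s0 : 0 < sin (ang n 1) by rewrite sin_ang_gt0.
rewrite lerBlDr lerBrDr ler_pdivrMr// -[_^-1]mul1r ler_pdivlMr// mulrC.
by rewrite Pi_eig_dirichlet sin_le1 dirichlet1_ge.
Qed.

(** With [x = ang n 1], the chain is [P_k + 1 <= 1 / sin(kx) <= 1 / sin(2x) <= cos x / sin x <= P_1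
    + 1]. Its second step uses that sine increases up to [pi / 2], its third that
    [2 cos(x)^2 >= 1]. *)
Lemma Pi_eig_le1_half n k : (4 <= n)%N -> (2 <= k)%N -> (k.*2 <= n)%N ->
  Pi_eig n k <= Pi_eig n 1.
Proof.
move=> n4 k2 kn; have n0 : (0 < n)%N by lia.
have half j : (j.*2 <= n)%N -> ang n j <= pi / 2.
  move=> jn; rewrite ler_pdivlMr// mulr_natr -angM muln2.
  by rewrite -[leRHS](@ang_self n)// ler_ang.
have lo j : - (pi / 2) <= ang n j.
  by rewrite (@le_trans _ _ 0) ?oppr_le0 /ang ?mulr_ge0 ?invr_ge0 ?pi_ge0 ?ler0n.
have s2 : sin (ang n 2) = (cos (ang n 1) * sin (ang n 1)) *+ 2.
  by rewrite -sin_mulr2n -angM.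
have s1_gt0 : 0 < sin (ang n 1) by rewrite sin_ang_gt0//; lia.
have s2_gt0 : 0 < sin (ang n 2) by rewrite sin_ang_gt0//; lia.
have sk_gt0 : 0 < sin (ang n k) by rewrite sin_ang_gt0//; lia.
have c1_gt0 : 0 < cos (ang n 1).
  by move: s2_gt0; rewrite s2 pmulrn_lgt0// pmulr_lgt0.
(* Here [4 <= n] enters: it gives [ang n 2 <= pi / 2], hence [0 <= cos(2x) = 2 cos(x)^2 - 1]. *)
have c1_ge : 1 <= cos (ang n 1) ^+ 2 *+ 2.
  have : 0 <= cos (ang n 2).
    by rewrite cos_ge0_pihalf// lo half.
  by rewrite -[2%N]mul1n angM cos_mulr2n subr_ge0.
have le_sin : sin (ang n 2) <= sin (ang n k).
  by rewrite ler_sin ?ler_ang// in_itv/= lo half.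
have /andP[lb _] := Pi_eig1_bounds n (ltnW (ltnW n4)).
apply: le_trans lb; rewrite lerBrDr.
have -> : Pi_eig n k + 1 = dirichlet n k / sin (ang n k).
  by rewrite -Pi_eig_dirichlet mulrC mulKf// gt_eqF.
apply: (@le_trans _ _ (sin (ang n 2))^-1).
  rewrite ler_pdivrMr// (le_trans (sin_le1 _))// mulrC ler_pdivlMr// mul1r.
  exact: le_sin.
rewrite -[_^-1]mul1r ler_pdivrMr// s2.
rewrite (_ : _ / _ * _ = cos (ang n 1) ^+ 2 *+ 2)//.
by field; rewrite gt_eqF.
Qed.

(** The reflection of [k] to [n - k] brings the upper half of the range to the lower half and stays
    at least 2. *)
Lemma Pi_eig_le1 n k : (4 <= n)%N -> (2 <= k)%N -> (k + 2 <= n)%N ->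
  Pi_eig n k <= Pi_eig n 1.
Proof.
move=> n4 k2 kn; have [kh|kh] := leqP k.*2 n; first exact: Pi_eig_le1_half.
by rewrite -Pi_eig_rev ?Pi_eig_le1_half//; lia.
Qed.

Lemma eig_k3_Pi n : (4 <= n)%N -> eig_k (Pi_mx R n) 3 = Pi_eig n 1.
Proof.
case: n => [|[|[|[|p]]]]// _; set n := p.+4.
pose rest := sort (fun x y : R => y <= x) [seq Pi_eig n k | k <- index_iota 2 p.+3].
have getr : transitive (fun x y : R => y <= x) by move=> x y z; apply/ge_trans.
have get : total (fun x y : R => y <= x) by move=> x y; apply: le_total.
(* The second copy of [Pi_eig n 1] stands for index [n - 1]; this double eigenvalue fills positions
   two and three. *)
rewrite (@eig_kE _ _ _ [:: Pi_eig n 0, Pi_eig n 1, Pi_eig n 1 & rest])//.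
split.
  rewrite /= Pi_eig_le0 lexx/= (path_sortedE getr) sort_sorted// andbT.
  apply/allP => x; rewrite mem_sort => /mapP[k]; rewrite mem_index_iota => kp ->.
  by rewrite Pi_eig_le1// /n; lia.
rewrite Pi_char_poly -(big_mkord xpredT (fun k => 'X - (Pi_eig n k)%:P)).
rewrite big_ltn// big_ltn// big_nat_recr//.
rewrite [RHS]big_cons [X in _ = _ * X]big_cons [X in _ = _ * (_ * X)]big_cons.
rewrite (perm_big [seq Pi_eig n k | k <- index_iota 2 p.+3]) ?perm_sort// big_map.
rewrite (_ : Pi_eig n p.+3 = Pi_eig n 1); last first.
  by rewrite -(Pi_eig_rev n 1)// /n subn1.
by congr (_ * (_ * _)); apply: mulrC.
Qed.

(** * Limits *)

Lemma cvg_ang1 : ang n.+1 1 @[n --> \oo] --> 0.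
Proof.
have -> : (fun n => ang n.+1 1) = (fun n => pi * harmonic n).
  by apply/funext => n; rewrite /ang mulr1.
by rewrite -[X in _ --> X](mulr0 pi); apply: cvgMl_tmp; apply: cvg_harmonic.
Qed.

(** The product is [pi * (sin h / h)] at [h = ang n.+1 1], and [sin h / h] tends to the derivative
    of sine at 0. *)
Lemma cvg_mul_sin_ang : n.+1%:R * sin (ang n.+1 1) @[n --> \oo] --> (pi : R).
Proof.
have D : sin h / h @[h --> 0^'] --> (1 : R).
  have : h^-1 *: (sin (h *: 1 + 0) - sin 0) @[h --> (0 : R)^'] --> (1 : R).
    have E : 'D_1 sin 0 = 1 :> R by rewrite derive_val cos0.
    rewrite -[X in _ --> X]E.
    exact: (@derivable_sin R 0).
  apply: cvg_trans; apply: near_eq_cvg; near=> h.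
  by rewrite sin0 subr0 addr0 /GRing.scale/= mulr1 mulrC.
(* The angles are positive, so the limit from the right passes to this sequence. *)
have /cvg_at_rightP/(_ (fun n => ang n.+1 1)) := cvg_dnbhs_at_right D.
move=> /(_ (conj (fun n => ang_gt0 n.+1 1 isT isT) cvg_ang1)) S.
have -> : (fun n => n.+1%:R * sin (ang n.+1 1)) =
    (fun n => pi * (sin (ang n.+1 1) / ang n.+1 1)).
  have divdivK (p m x : R) : p != 0 -> m != 0 -> m * x = p * (x / (p / m)).
    by move=> p0 m0; field; rewrite m0 p0.
  apply/funext => n; rewrite [RHS](_ : _ = pi * (sin (ang n.+1 1) / (pi / n.+1%:R))).
    by apply: divdivK; rewrite ?pnatr_eq0 ?gt_eqF ?pi_gt0.
  by rewrite {2}/ang mulr1.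
by rewrite -[X in _ --> X]mulr1; apply: cvgMl_tmp.
Unshelve. all: by end_near.
Qed.

End Angles.

Theorem theorem3p14 (R : realType) :
  (fun n : nat => eig_k (Pi_mx R n) 3 / n%:R : R) @ \oo --> (pi^-1 : R).
Proof.
(* Shifting the index makes every denominator nonzero. *)
rewrite -cvg_shiftS.
pose a n : R := (n.+1%:R * sin (ang R n.+1 1))^-1.
have a_cvg : a @ \oo --> (pi^-1 : R).
  by apply: cvgV (@cvg_mul_sin_ang R); rewrite gt_eqF ?pi_gt0.
have inv0 : (n.+1%:R^-1 : R) @[n --> \oo] --> (0 : R) := @cvg_harmonic R.
(* These are the bounds of [Pi_eig1_bounds] divided by [n.+1]; both tend to [pi^-1] because the
   cosine factor tends to 1. *)
apply: (@squeeze_cvgr _ _ _ _ (fun n => cos (ang R n.+1 1) * a n - n.+1%:R^-1)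
  (fun n => a n - n.+1%:R^-1)).
- near=> n.
  have n4 : (4 <= n.+1)%N by near: n; exists 3%N.
  rewrite /= eig_k3_Pi//.
  have /andP[lb ub] := Pi_eig1_bounds R n.+1 (ltnW (ltnW n4)).
  have aE : a n = (sin (ang R n.+1 1))^-1 * n.+1%:R^-1 by rewrite /a invfM mulrC.
  rewrite aE mulrA -{2 6}[n.+1%:R^-1]mul1r -!mulrBl.
  by rewrite !ler_pM2r ?invr_gt0 ?ltr0n// lb ub.
- rewrite -[X in _ --> X]subr0 -[X in X - 0]mul1r; apply: cvgB inv0.
  apply: cvgM a_cvg; rewrite -(@cos0 R).
  exact: continuous_cvg (@continuous_cos R 0) (@cvg_ang1 R).
- by rewrite -[X in _ --> X]subr0; apply: cvgB inv0.
Unshelve. all: by end_near.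
Qed.
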